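(* Let $G$ be a finite group with $G/Z(G)\cong D_{2m}$, $m\ge3$. Then $\Gamma_G$ is Q-integral iff $m$ is odd.
   Context: $D_{2m}=\langle x,y\mid x^m=y^2=1,\ yxy^{-1}=x^{-1}\rangle$. The NCCC-graph $\Gamma_G$ of a finite non-abelian group $G$ with center $Z(G)$ has vertex set $\{x^G: x\in G\setminus Z(G)\}$ ($x^G$ the conjugacy class of $x$), distinct vertices $x^G,y^G$ adjacent iff $x'y'\neq y'x'$ for all $x'\in x^G,y'\in y^G$. A graph is Q-integral if all eigenvalues of its signless Laplacian $Q=D+A$ ($A$ adjacency, $D$ degree matrix) are integers. *)

(* Defs.v *)
From HB Require Import structures.
From mathcomp Require Import all_boot all_order all_algebra all_fingroup all_solvable all_field.
Set Implicit Arguments. Unset Strict Implicit. Unset Printing Implicit Defensive.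
Import GRing.Theory Num.Theory.

Local Open Scope group_scope.

Definition nccc_vertices (gT : finGroupType) (G : {group gT}) : {set {set gT}} :=
  [set C in classes G | [exists x in C, x \notin 'Z(G)]].

Definition nccc_adj (gT : finGroupType) (C D : {set gT}) : bool :=
  (C != D) && [forall x in C, forall y in D, x * y != y * x].

Definition nccc_n (gT : finGroupType) (G : {group gT}) : nat := #|nccc_vertices G|.

Definition nccc_vertex (gT : finGroupType) (G : {group gT}) (i : 'I_(nccc_n G))
  : {set gT} := enum_val i.

Local Open Scope ring_scope.

Definition nccc_adjmx (gT : finGroupType) (G : {group gT})
  : 'M[algC]_(nccc_n G) :=
  \matrix_(i, j) (nccc_adj (nccc_vertex i) (nccc_vertex j))%:R.

Definition nccc_degmx (gT : finGroupType) (G : {group gT})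
  : 'M[algC]_(nccc_n G) :=
  diag_mx (\row_i \sum_j nccc_adjmx G i j).

Definition nccc_signless_laplacian (gT : finGroupType) (G : {group gT})
  : 'M[algC]_(nccc_n G) := nccc_degmx G + nccc_adjmx G.

Definition Q_integral_nccc (gT : finGroupType) (G : {group gT}) : Prop :=
  forall a : algC, eigenvalue (nccc_signless_laplacian G) a -> a \in Num.int.

(* Main.v *)
(* Let z be the order of Z(G) and A the preimage in G of the rotation subgroup
   of D_2m: it is abelian of index 2, and no element outside A commutes with a
   noncentral element of A. Two elements outside A commute iff they are equal
   modulo Z(G), so the classes of g and h outside A are non-adjacent iff the
   images of g and h are conjugate reflections. Hence the graph is complete
   multipartite, with one part for A and one for each class of reflections of
   D_2m. If m is odd it is complete bipartite, with eigenvalues among 0, the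
   sizes of the two parts, and their sum. If m is even it is complete
   tripartite with parts of sizes (m - 1) q, q, q, where 2 q = z, and vectors
   constant on each part and equal on the last two give as eigenvalues the
   roots of X^2 - (m + 3) q X + 4 q^2; the discriminant q^2 ((m + 3)^2 - 16)
   is never a square for m >= 3. *)
Require Import Defs.
From mathcomp Require Import all_boot all_order all_algebra all_fingroup all_solvable all_field.
From mathcomp Require Import zify ring.
Set Implicit Arguments. Unset Strict Implicit. Unset Printing Implicit Defensive.
Import Order.TTheory GRing.Theory Num.Theory.

Local Open Scope group_scope.

(** * Rotations and reflections of a dihedral group *)

Lemma rdiv_index2 (gT : finGroupType) (G A : {group gT}) (g h : gT) :
  A \subset G -> #|G : A| = 2 -> g \in G :\: A -> h \in G :\: A -> g * h^-1 \in A.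
Proof.
by move=> sAG iAG gG'A hG'A; rewrite -mem_rcoset (rcoset_index2 sAG iAG hG'A).
Qed.

(** The generators have orders at most [m] and 2, and their cycles multiply to a group of order
    [2 * m], so [x] has order exactly [m]. An element off [<[x]>] is a rotation times [y]: the
    rotation centralises [<[x]>] and [y] inverts it. *)
Lemma dihedral_generator (gT : finGroupType) (D : {group gT}) (m : nat) :
  1 < m -> D \isog 'D_(2 * m) ->
  exists x, [/\ x \in D, #[x] = m, #|D : <[x]>| = 2 &
    {in D :\: <[x]> & <[x]>, forall u w, w ^ u = w^-1}].
Proof.
move=> m_gt1 isoD; rewrite mul2n in isoD.
have oD : #|D| = m.*2 by rewrite (card_isog isoD) card_dihedral.
have /existsP[[x y] /=] := isoGrp_hom (isoGrp_trans isoD (Grp_dihedral m_gt1)).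
rewrite !xpair_eqE => /and4P[/eqP defD /eqP xm /eqP y2 /eqP xy].
have nxy : y \in 'N(<[x]>) by rewrite -cycle_subG cycle_subG inE -cycleJ xy cycleV.
have defD' : <[x]> * <[y]> = D by rewrite -norm_joinEr ?cycle_subG.
have ox_le : (#[x] <= m)%N by apply: dvdn_leq; [exact: ltnW | rewrite order_dvdn xm].
have oy_le : (#[y] <= 2)%N by apply: dvdn_leq => //; rewrite order_dvdn y2.
have Dx : x \in D by rewrite -cycle_subG -defD' mulG_subl.
have ox : #[x] = m.
  apply/eqP; rewrite eqn_leq ox_le /= -leq_double -oD -defD'.
  apply: leq_trans (_ : (#[x] * #[y] <= _)%N); last by rewrite -muln2 leq_mul.
  by rewrite !orderE mul_cardG leq_pmulr ?cardG_gt0.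
have ixD : #|D : <[x]>| = 2.
  by rewrite -divgS ?cycle_subG // -orderE ox oD -muln2 mulKn // ltnW.
exists x; split=> // u w /setDP[]; rewrite -defD' => /mulsgP[v t xv yt ->] nxu xw.
have [k lt_k2 def_t] : exists2 k, (k < 2)%N & t = y ^+ k.
  by have [k lt_k ->] := cyclePmin yt; exists k => //; apply: leq_trans oy_le.
case: k lt_k2 def_t => [|[|//]] _ def_t.
  by rewrite def_t mulg1 xv in nxu.
case/cycleP: xw => i ->; case/cycleP: xv => j ->.
rewrite def_t expg1 conjgM [_ ^ (x ^+ j)]conjgE -expgD addnC expgD mulKg.
by rewrite conjXg xy expgVn.
Qed.

(** A rotation [w] conjugates [u] to [w ^- 2 * u], so the class is obtained by multiplying [u] by
    squares of rotations. *)
Lemma reflection_class (gT : finGroupType) (D : {group gT}) (x u : gT) :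
  x \in D -> #|D : <[x]>| = 2 ->
  {in D :\: <[x]> & <[x]>, forall u w, w ^ u = w^-1} ->
  u \in D :\: <[x]> -> u ^: D = <[x ^+ 2]> :* u.
Proof.
move=> Dx ixD invx xD'u; have sxD : <[x]> \subset D by rewrite cycle_subG.
have conju w : w \in <[x]> -> u ^ w = w ^- 2 * u.
  move=> xw; rewrite conjgE.
  have <- : w^-1 * u = u * w by rewrite conjgC conjVg invx ?invgK.
  by rewrite mulgA -invMg.
apply/setP=> v; apply/imsetP/rcosetP=> [[d Dd ->]|[w]].
  have [w xw ->] : exists2 w, w \in <[x]> & u ^ d = u ^ w.
    have [xd|nxd] := boolP (d \in <[x]>); first by exists d.
    (* Since [u] centralises itself, [d] can be replaced by [u * d], which is a rotation. *)
    exists (u * d); last by rewrite conjgM [u ^ u]conjgE mulKg.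
    by rewrite -[d]invgK (rdiv_index2 sxD ixD) // inE groupV nxd groupV.
  rewrite conju //; exists (w ^- 2) => //.
  by case/cycleP: xw => i ->; rewrite groupV -expgM mulnC expgM mem_cycle.
case/cycleP=> i -> ->; exists (x ^- i).
  by rewrite groupV groupX.
by rewrite conju ?groupV ?mem_cycle // expgVn invgK -!expgM mulnC.
Qed.

Lemma nccc_vertex_repr (gT : finGroupType) (G : {group gT}) (C : {set gT}) :
  C \in nccc_vertices G -> repr C \in G :\: 'Z(G) /\ C = repr C ^: G.
Proof.
rewrite inE => /andP[/imsetP[h Gh ->] /exists_inP[_ /imsetP[v Gv ->] nZhv]].
have /imsetP[u Gu ->] := mem_repr _ (class_refl G h).
have nZ w : w \in G -> w \in 'N('Z(G)) := subsetP (normal_norm (center_normal G)) w.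
rewrite in_setD memJ_norm ?nZ // -(memJ_norm _ (nZ v Gv)) nZhv groupJ //.
by rewrite classGidl.
Qed.

(** * Commutation and class sizes with an abelian subgroup of index 2 *)

Section AbelianIndexTwo.

Variables (gT : finGroupType) (G A K : {group gT}) (s : gT).
Hypotheses (sAG : A \subset G) (cAA : abelian A) (iAG : #|G : A| = 2).
Hypotheses (sZK : 'Z(G) \subset K) (sKA : K \subset A).
(** [K] models the preimage of the squares of rotations. [iKA] says that its index in [A] is at most
    2, which covers both parities of [m]; [clG'A] says that a class outside [A] fills, modulo the
    centre, a coset of [K]. *)
Hypothesis iKA : {in A :\: K &, forall a b, a * b^-1 \in K}.
Hypothesis clG'A : forall g h, g \in G :\: A ->
  reflect (exists2 u, u \in G & h * (g ^ u)^-1 \in 'Z(G)) (h \in K :* g).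
Hypothesis G'As : s \in G :\: A.

Let sZA : 'Z(G) \subset A := subset_trans sZK sKA.
Let nAG : A <| G := index2_normal sAG iAG.

(** The centraliser of [g] contains [A] and an element outside [A], hence all of [G]. *)
Lemma commute_index2 g h : g \in A -> h \in G :\: A -> commute g h -> g \in 'Z(G).
Proof.
move=> Ag G'Ah cgh; have [Gh nAh] := setDP G'Ah.
apply/centerP; split=> [|y Gy]; first exact: (subsetP sAG).
have [Ay|nAy] := boolP (y \in A); first exact: (centsP cAA).
have G'Ay : y \in G :\: A by rewrite inE nAy.
rewrite -(mulgKV h y); apply: commuteM cgh.
exact: (centsP cAA) Ag _ (rdiv_index2 sAG iAG G'Ay G'Ah).
Qed.

Lemma commute_outside g h : g \in G :\: A -> h \in G :\: A ->
  reflect (commute g h) (h * g^-1 \in 'Z(G)).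
Proof.
move=> G'Ag G'Ah; have [Gg _] := setDP G'Ag.
apply: (iffP idP) => [/centerP[_ cz]|cgh].
  rewrite -(mulgKV g h); apply: commuteM; last exact: commute_refl.
  exact/commute_sym/cz.
apply: commute_index2 (rdiv_index2 sAG iAG G'Ah G'Ag) G'Ag _.
apply/commute_sym/commuteM => //; exact/commuteV/commute_refl.
Qed.

(* The parts of the complete multipartite graph: the noncentral classes inside
   A, and the classes outside A, split according to their coset of K. *)
Definition part (g : gT) : option bool :=
  if g \in A then None else Some (g \in K :* s).

(** Comparing with the single coset [K :* s] is enough: by [iKA], at most one other coset of [K]
    lies outside [A]. *)
Lemma part_outside g h : g \in G :\: A -> h \in G :\: A ->
  (part g == part h) = (h \in K :* g).
Proof.
move=> G'Ag G'Ah; have [[_ nAg] [_ nAh]] := (setDP G'Ag, setDP G'Ah).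
rewrite /part (negPf nAg) (negPf nAh) (inj_eq Some_inj).
have Aa := rdiv_index2 sAG iAG G'Ag G'As; have Ab := rdiv_index2 sAG iAG G'Ah G'As.
have -> : (h \in K :* g) = (h * s^-1 * (g * s^-1)^-1 \in K).
  by rewrite mem_rcoset invMg invgK mulgA mulgKV.
rewrite !mem_rcoset; have [Ka|nKa] := boolP (g * s^-1 \in K).
  by rewrite [RHS]groupMr ?groupV //; case: (_ \in K).
have [Kb|nKb] := boolP (h * s^-1 \in K).
  by rewrite [RHS]groupMl // groupV (negPf nKa).
by rewrite iKA // inE ?nKa ?nKb.
Qed.

Lemma part_commute g h : g \in G :\: 'Z(G) -> h \in G :\: 'Z(G) ->
  commute g h -> part g = part h.
Proof.
move=> /setDP[Gg nZg] /setDP[Gh nZh] cgh.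
have [Ag|nAg] := boolP (g \in A); have [Ah|nAh] := boolP (h \in A).
- by rewrite /part Ag Ah.
- by case/negP: nZg; apply: commute_index2 cgh; rewrite // inE nAh.
- by case/negP: nZh; apply: commute_index2 (commute_sym cgh); rewrite // inE nAg.
have [G'Ag G'Ah] : g \in G :\: A /\ h \in G :\: A by rewrite !inE nAg nAh.
apply/eqP; rewrite part_outside // mem_rcoset (subsetP sZK) //.
exact/commute_outside.
Qed.

Lemma part_conj g u : g \in G -> u \in G -> part (g ^ u) = part g.
Proof.
move=> Gg Gu; have nAu : u \in 'N(A) := subsetP (normal_norm nAG) u Gu.
have [Ag|nAg] := boolP (g \in A); first by rewrite /part memJ_norm ?Ag.
have G'Ag : g \in G :\: A by rewrite inE nAg.
have G'Agu : g ^ u \in G :\: A by rewrite inE memJ_norm ?nAg ?groupJ.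
apply/esym/eqP; rewrite part_outside //.
by apply/clG'A => //; exists u => //; rewrite mulgV group1.
Qed.

(** Inside [A] the elements already commute; outside, [clG'A] yields a conjugate of [g] equal to [h]
    modulo the centre. *)
Lemma part_commute_conj g h : g \in G -> h \in G -> part g = part h ->
  exists2 u, u \in G & commute (g ^ u) h.
Proof.
move=> Gg Gh; have [Ag|nAg] := boolP (g \in A).
  rewrite /part Ag; case: ifP => // Ah _.
  by exists 1; rewrite ?group1 // conjg1; apply: (centsP cAA).
have G'Ag : g \in G :\: A by rewrite inE nAg.
have [Ah|nAh] := boolP (h \in A); first by rewrite /part Ah (negPf nAg).
have G'Ah : h \in G :\: A by rewrite inE nAh.
move/eqP; rewrite part_outside // => /(clG'A _ G'Ag)[u Gu zu]; exists u => //.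
apply/commute_outside => //.
by rewrite inE memJ_norm ?nAg ?groupJ // (subsetP (normal_norm nAG)).
Qed.

(** The label is constant on classes. Equal labels give commuting representatives, and commuting
    noncentral elements have equal labels. *)
Lemma nccc_adj_class g h : g \in G :\: 'Z(G) -> h \in G :\: 'Z(G) ->
  nccc_adj (g ^: G) (h ^: G) = (part g != part h).
Proof.
have clP x y : x \in G :\: 'Z(G) -> y \in x ^: G ->
    (y \in G :\: 'Z(G)) * (part y = part x).
  move=> /setDP[Gx nZx] /imsetP[u Gu ->].
  have nZu := subsetP (normal_norm (center_normal G)) u Gu.
  by rewrite part_conj // in_setD memJ_norm // nZx groupJ.
move=> G'g G'h; have [[Gg _] [Gh _]] := (setDP G'g, setDP G'h).
apply/andP/idP=> [[_ /forall_inP adj]|neq_gh].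
  apply/eqP=> /(part_commute_conj Gg Gh)[u Gu cguh].
  have /forall_inP/(_ h (class_refl G h)) := adj _ (memJ_class g Gu).
  by rewrite cguh eqxx.
split.
  by apply: contraNneq neq_gh => defC; rewrite -(clP h g) // -defC class_refl.
apply/forall_inP=> x /(clP _ _ G'g)[G'x px]; apply/forall_inP=> y /(clP _ _ G'h)[G'y py].
by apply: contraNneq neq_gh => cxy; rewrite -px -py (part_commute G'x G'y cxy).
Qed.

(** The centraliser of [g] is exactly [A]. *)
Lemma card_class_inside g : g \in A :\: 'Z(G) -> #|g ^: G| = 2.
Proof.
move=> /setDP[Ag nZg]; rewrite -index_cent1 -iAG; congr #|_ : _|.
apply/setP=> h; rewrite inE cent1E; apply/andP/idP=> [[Gh /eqP cgh]|Ah].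
  apply: contraR nZg => nAh; apply: (@commute_index2 g h) => //.
  by rewrite inE nAh.
by split; [apply: (subsetP sAG) | apply/eqP/(centsP cAA)].
Qed.

(** The centraliser of [g] is the union of ['Z(G)] and ['Z(G) :* g], so it has twice the order of
    the centre. *)
Lemma card_class_outside g : g \in G :\: A -> (#|g ^: G| * #|'Z(G)| = #|A|)%N.
Proof.
move=> G'Ag; have [Gg nAg] := setDP G'Ag.
suffices oC : #|'C_G[g]| = #|'Z(G)|.*2.
  apply/double_inj; rewrite -mul2n mulnCA mul2n -oC -index_cent1 mulnC.
  by rewrite Lagrange ?subsetIl // -(Lagrange sAG) iAG muln2.
rewrite -(cardsID A) -addnn; congr (_ + _)%N.
  apply: eq_card => h; rewrite inE; apply/andP/idP=> [[/setIP[Gh /cent1P chg] Ah]|Zh].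
    exact: commute_index2 G'Ag _.
  have [Gh cz] := centerP _ _ Zh; split; last exact: (subsetP sZA).
  by rewrite inE Gh; apply/cent1P/cz.
rewrite -(card_rcoset 'Z(G) g); apply: eq_card => h; rewrite mem_rcoset.
apply/setDP/idP=> [[/setIP[Gh /cent1P chg] nAh]|zhg].
  have G'Ah : h \in G :\: A by rewrite inE nAh.
  exact/(commute_outside G'Ag G'Ah)/commute_sym.
have Ahg := subsetP sZA _ zhg.
have nAh : h \notin A by rewrite -(mulgKV g h) groupMl.
have Gh : h \in G by rewrite -(mulgKV g h) groupM // (subsetP sAG).
split=> //; rewrite inE Gh; apply/cent1P/commute_sym/commute_outside => //.
by rewrite inE nAh.
Qed.

(** The noncentral elements with label [c] are partitioned into classes, all of size [k]. *)
Lemma card_part c k :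
  {in G :\: 'Z(G), forall g, part g = c -> #|g ^: G| = k} ->
  (#|[set C in nccc_vertices G | part (repr C) == c]| * k)%N =
  #|[set g in G :\: 'Z(G) | part g == c]|.
Proof.
move=> clk; set S := [set g in G :\: 'Z(G) | part g == c].
have -> : [set C in nccc_vertices G | part (repr C) == c] = orbit 'J G @: S.
  apply/setP=> C; rewrite inE; apply/andP/imsetP=> [[vC pC]|[g]].
    have [G'g defC] := nccc_vertex_repr vC.
    by exists (repr C); rewrite ?orbitJ // inE G'g.
  rewrite inE => /andP[G'g pg] ->; rewrite orbitJ.
  have [Gg nZg] := setDP G'g; split.
    rewrite inE mem_classes //; apply/exists_inP; exists g => //.
    exact: class_refl.
  have /imsetP[u Gu ->] := mem_repr _ (class_refl G g).
  by rewrite part_conj.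
apply/esym/card_uniform_partition => [_ /imsetP[g /setIdP[G'g /eqP pg] ->]|].
  by rewrite orbitJ clk.
apply: orbit_partition; apply/actsP=> u Gu g /=.
have nZu := subsetP (normal_norm (center_normal G)) u Gu.
have memS h : (h \in S) = (h \in G :\: 'Z(G)) && (part h == c) by rewrite in_set.
rewrite !memS !in_setD (memJ_norm g nZu) groupJr //.
by case Gg: (g \in G); rewrite ?andbF // part_conj.
Qed.

Lemma card_part_inside :
  (#|[set C in nccc_vertices G | part (repr C) == None]| * 2)%N =
  (#|A| - #|'Z(G)|)%N.
Proof.
rewrite card_part => [|g /setDP[Gg nZg]]; last first.
  rewrite /part; case: ifP => // Ag _; apply: card_class_inside.
  by rewrite inE Ag nZg.
rewrite -cardsDS //; apply: eq_card => g; rewrite !in_set /part.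
case: ifP => [Ag|_]; last by rewrite andbF andbF.
by rewrite (subsetP sAG) ?andbT.
Qed.

Lemma card_part_outside b k : (k * #|'Z(G)|)%N = #|A| ->
  (#|[set C in nccc_vertices G | part (repr C) == Some b]| * k)%N =
  if b then #|K| else (#|A| - #|K|)%N.
Proof.
move=> kZ; rewrite card_part => [|g /setDP[Gg nZg]]; last first.
  rewrite /part; case: ifP => // nAg _; apply/eqP.
  rewrite -(eqn_pmul2r (cardG_gt0 'Z(G))) card_class_outside ?kZ //.
  by rewrite inE nAg.
have sKsG : K :* s \subset G :\: A.
  rewrite -(rcoset_index2 sAG iAG G'As); exact: mulSg.
have defG'A : [set g in G :\: 'Z(G) | part g == Some b] =
    if b then K :* s else (G :\: A) :\: (K :* s).
  apply/setP=> g; rewrite in_set in_setD /part.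
  have [Ag|nAg] := boolP (g \in A).
    rewrite andbF; case: b; rewrite ?inE ?Ag ?andbF //.
    by apply/esym/negP=> /(subsetP sKsG); rewrite inE Ag.
  rewrite (contra (subsetP sZA g)) //= (inj_eq Some_inj).
  case: b; last by rewrite !in_set nAg andbC; case: (g \in K :* s).
  rewrite eqb_id; apply: andb_idl => /(subsetP sKsG).
  by rewrite inE => /andP[].
rewrite defG'A; case: b {defG'A}; first exact: card_rcoset.
rewrite cardsDS // card_rcoset cardsDS // -(Lagrange sAG) iAG muln2 -addnn.
by rewrite addnK.
Qed.

End AbelianIndexTwo.

(** * The parts of the graph and their sizes for a dihedral central quotient *)

Lemma nccc_multipartite (gT : finGroupType) (G : {group gT}) (m : nat) :
  2 < m -> G / 'Z(G) \isog 'D_(2 * m) ->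
  exists p : gT -> option bool,
  [/\ {in G :\: 'Z(G) &, forall g h, nccc_adj (g ^: G) (h ^: G) = (p g != p h)},
      odd m -> {in G :\: 'Z(G), forall g, p g != Some false} &
      ~~ odd m -> exists2 q, 0 < q &
        #|[set C in nccc_vertices G | p (repr C) == None]| = (m.-1 * q)%N /\
        forall b, #|[set C in nccc_vertices G | p (repr C) == Some b]| = q].
Proof.
move=> m_gt2 isoD; have m_gt0 : 0 < m := ltnW (ltnW m_gt2).
have [x [Dx ox ixD invx]] := dihedral_generator (ltnW m_gt2) isoD.
have nZG := center_normal G; have nZ := subsetP (normal_norm nZG).
pose A := (coset 'Z(G) @*^-1 <[x]>)%G.
pose K := (coset 'Z(G) @*^-1 <[x ^+ 2]>)%G.
have defG : coset 'Z(G) @*^-1 (G / 'Z(G)) = G := quotientGK nZG.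
have sAG : A \subset G by rewrite sub_cosetpre_quo // cycle_subG.
have iAG : #|G : A| = 2 by rewrite -ixD -index_cosetpre defG.
have oA : #|A| = (m * #|'Z(G)|)%N by rewrite card_cosetpre -orderE ox mulnC.
have oK : #|K| = (m %/ gcdn m 2 * #|'Z(G)|)%N.
  by rewrite card_cosetpre -orderE orderXgcd ox mulnC.
have sZK : 'Z(G) \subset K by apply: sub_cosetpre.
have sKA : K \subset A by rewrite cosetpreSK cycleX.
have cAA : abelian A.
  (* ['Z(G)] is central in [A], with cyclic quotient [<[x]>]. *)
  apply: (@cyclic_factor_abelian _ ('Z(G))%G).
    rewrite subsetI (subset_trans sZK sKA) centsC (subset_trans sAG) //.
    by rewrite centsC subsetIr.
  by rewrite cosetpreK cycle_cyclic.
(* For odd [m] the square of [x] still generates all rotations. *)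
have oddKA : odd m -> K :=: A.
  move=> odd_m; apply/eqP; rewrite eqEcard sKA oA oK.
  have /eqP -> : coprime m 2 by rewrite coprimen2.
  by rewrite divn1 /=.
have evenK : ~~ odd m -> #|K| = (m./2 * #|'Z(G)|)%N.
  move=> even_m; rewrite oK -divn2; congr (_ %/ _ * _)%N.
  by apply/gcdn_idPr; rewrite dvdn2.
have iKA : {in A :\: K &, forall a b, a * b^-1 \in K}.
  have [/oddKA -> a b|even_m a b] := boolP (odd m); first by rewrite setDv inE.
  apply: rdiv_index2 => //; apply/eqP.
  rewrite -(eqn_pmul2l (cardG_gt0 K)) Lagrange // oA evenK // mulnAC.
  by rewrite muln2 halfK (negPf even_m) subn0.
have [s G'As] : exists s, s \in G :\: A.
  by apply/set0Pn; rewrite setD_eq0 -indexg_eq1 iAG.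
(* This is [reflection_class] in the quotient, pulled back along [coset 'Z(G)]. *)
have clG'A g h : g \in G :\: A ->
    reflect (exists2 u, u \in G & h * (g ^ u)^-1 \in 'Z(G)) (h \in K :* g).
  case/setDP=> Gg nAg.
  have D'g : coset 'Z(G) g \in (G / 'Z(G)) :\: <[x]>.
    rewrite inE mem_quotient // andbT; apply: contra nAg => xg.
    by rewrite mem_morphpre ?nZ.
  have cl := reflection_class Dx ixD invx D'g.
  have KgE w : w \in G -> (w \in K :* g) = (coset 'Z(G) w \in <[x ^+ 2]> :* coset 'Z(G) g).
    move=> Gw; have nZwg : w * g^-1 \in 'N('Z(G)) by rewrite nZ ?groupM ?groupV.
    have -> : (coset 'Z(G) w \in <[x ^+ 2]> :* coset 'Z(G) g) =
              (coset 'Z(G) (w * g^-1) \in <[x ^+ 2]>).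
      by rewrite mem_rcoset morphM ?morphV ?groupV ?nZ.
    by rewrite mem_rcoset; apply/morphpreP/idP=> [[] | ].
  apply: (iffP idP) => [Kgh|[u Gu zu]].
    have Gh : h \in G.
      move: Kgh; rewrite mem_rcoset => /(subsetP sKA)/(subsetP sAG).
      by rewrite groupMr ?groupV.
    move: Kgh; rewrite KgE // -cl => /imsetP[ub /morphimP[u nZu Gu ->] hE].
    exists u => //; rewrite -mem_rcoset; apply/rcoset_kercosetP; rewrite ?nZ ?groupJ //.
    by rewrite hE morphJ ?nZ.
  have Gh : h \in G.
    by move/(subsetP (normal_sub nZG)): zu; rewrite groupMr ?groupV ?groupJ.
  rewrite KgE // -cl; apply/imsetP; exists (coset 'Z(G) u); first exact: mem_quotient.
  rewrite -morphJ ?nZ //; apply/rcoset_kercosetP; rewrite ?nZ ?groupJ //.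
  by rewrite mem_rcoset.
exists (part A K s); split=> [g h G'g G'h|/oddKA defK g /setDP[Gg _]|even_m].
- exact: nccc_adj_class.
- rewrite /part; case: ifP => // nAg; rewrite defK (rcoset_index2 sAG iAG G'As).
  by rewrite inE nAg Gg.
have z_gt0 := cardG_gt0 'Z(G).
have cN := card_part_inside sAG cAA iAG sZK sKA iKA clG'A G'As.
have cS b := card_part_outside sAG cAA iAG sZK sKA iKA clG'A G'As b (esym oA).
have m2 : m = (m./2 * 2)%N by rewrite muln2 halfK (negPf even_m) subn0.
set N := fun c => #|[set C in nccc_vertices G | part A K s (repr C) == c]|.
(* Classes outside [A] have [m] elements, and for even [m] each of the two cosets of [K] there has
   [m./2 * #|'Z(G)|] elements. *)
have Nb b : (N (Some b) * 2 = #|'Z(G)|)%N.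
  have cSb : (N (Some b) * m = m./2 * #|'Z(G)|)%N.
    rewrite [LHS]cS; case: b; rewrite ?oA evenK // -mulnBl; congr (_ * _)%N; lia.
  apply/eqP; rewrite -(eqn_pmul2l (_ : 0 < m./2)); last by rewrite half_gt0 ltnW.
  by rewrite mulnCA -m2 cSb.
exists (N (Some true)); first by rewrite -(ltn_pmul2r (isT : 0 < 2)) Nb.
split=> [|b]; apply/eqP; rewrite -(eqn_pmul2r (isT : 0 < 2)); last first.
  by rewrite [X in X == _]Nb [X in _ == X]Nb.
rewrite [X in X == _]cN -mulnA [X in _ == (_ * X)%N]Nb oA.
by rewrite -{2}[#|_|]mul1n -mulnBl subn1.
Qed.

(* Signless Laplacian eigenvalues of complete multipartite graphs *)
Local Close Scope group_scope.
Local Open Scope ring_scope.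

Section ColouredSignlessLaplacian.

Variables (F : fieldType) (n : nat) (T : eqType) (col : 'I_n -> T).

Definition col_adjmx : 'M[F]_n := \matrix_(i, j) (col i != col j)%:R.

Definition signless (M : 'M[F]_n) : 'M[F]_n :=
  diag_mx (\row_i \sum_j M i j) + M.

Lemma mul_col_signless (v : 'rV[F]_n) j :
  (v *m signless col_adjmx) 0 j =
  v 0 j * (#|[pred i | col i != col j]|)%:R + \sum_(i | col i != col j) v 0 i.
Proof.
rewrite mulmxDr mxE mul_mx_diag !mxE; congr (v 0 j * _ + _).
  rewrite -sum1_card natr_sum [RHS]big_mkcond /=; apply: eq_bigr => i _.
  by rewrite mxE inE eq_sym; case: (_ == _).
rewrite [RHS]big_mkcond; apply: eq_bigr => i _; rewrite mxE.
by case: (_ == _); rewrite ?mulr0 ?mulr1.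
Qed.

End ColouredSignlessLaplacian.

(** With [N b] the size of part [b] and [S b] the sum of an eigenvector over it, the eigenvector
    equation summed over each part gives two linear relations between the sums. *)
Lemma bipartite_eigenvalue (n : nat) (col : 'I_n -> bool) (a : algC) :
  eigenvalue (signless (col_adjmx algC col)) a -> a \in Num.int.
Proof.
case/eigenvalueP=> v va v_neq0.
pose N b : algC := (#|[pred i | col i == b]|)%:R.
pose S b := \sum_(i | col i == b) v 0 i.
have negcol b b' : (b != b') = (b == ~~ b') by case: b b' => [] [].
have row_eq j : (a - N (~~ col j)) * v 0 j = S (~~ col j).
  have := mul_col_signless col v j; rewrite va mxE mulrBl => ->.
  rewrite [N _ * _]mulrC.
  under eq_bigl => i do rewrite negcol.
  rewrite (eq_card (B := [pred i | col i == ~~ col j])) => [|i].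
    by rewrite mulrC addrAC subrr add0r.
  by rewrite !inE negcol.
have sum_eq b : (a - N (~~ b)) * S b = N b * S (~~ b).
  rewrite {1}/S mulr_sumr mulr_natl -sumr_const.
  by apply: eq_bigr => i /eqP <-; rewrite row_eq.
have [/forallP N_a|] := boolP [forall b, a != N b]; last first.
  by case/forallPn=> b /negPn/eqP ->; apply: rpred_nat.
(* If both sums vanished, [row_eq] would force [v] to be 0, as [a] is not a part size here. *)
have [b Sb_neq0] : exists b, S b != 0.
  apply/existsP; apply: contraNT v_neq0 => /existsPn S0.
  apply/eqP/rowP=> j; rewrite mxE; apply/eqP.
  have /eqP := row_eq j; rewrite (eqP (negPn (S0 _))) mulf_eq0 subr_eq0.
  by rewrite (negPf (N_a _)).
(* Eliminate [S (~~ b)] between the two relations. *)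
have : a * (a - (N b + N (~~ b))) * S b = 0.
  have e1 := sum_eq b; have := sum_eq (~~ b); rewrite negbK => e2.
  have -> : a * (a - (N b + N (~~ b))) * S b =
    (a - N b) * ((a - N (~~ b)) * S b) - N b * (N (~~ b) * S b) by ring.
  by rewrite e1 -e2; ring.
move/eqP; rewrite !mulf_eq0 (negPf Sb_neq0) orbF subr_eq0.
by case/orP=> /eqP ->; rewrite ?rpred0 ?rpredD ?rpred_nat.
Qed.

Lemma sum_option_bool (V : nmodType) (P : pred (option bool)) (g : option bool -> V) :
  \sum_(c | P c) g c =
  (if P None then g None else 0) +
  ((if P (Some true) then g (Some true) else 0) +
   (if P (Some false) then g (Some false) else 0)).
Proof.
rewrite big_mkcond (bigD1 None) //= (bigD1 (Some true)) //=.
by rewrite (bigD1 (Some false)) //= big1 ?addr0 // => -[[]|].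
Qed.

Lemma tripartite_eigenvalue (n p q : nat) (col : 'I_n -> option bool) (a : algC) :
  #|[pred i | col i == None]| = p ->
  (forall b, #|[pred i | col i == Some b]| = q) ->
  (0 < p)%N -> (0 < q)%N ->
  a ^+ 2 - (p + 4 * q)%:R * a + (4 * q ^ 2)%:R = 0 ->
  eigenvalue (signless (col_adjmx algC col)) a.
Proof.
move=> cN cS p_gt0 q_gt0 quad.
(* With these values the eigenvector equation on the [None] part is an identity, and on each of the
   other two parts it is [quad]. *)
pose f (c : option bool) : algC := if c is None then (2 * q)%:R else a - (2 * q)%:R.
have sumcol (g : option bool -> algC) j :
    \sum_(i | col i != col j) g (col i) =
    \sum_(c | c != col j) (if c is None then p else q)%:R * g c.
  rewrite (partition_big col (fun c => c != col j)) //=.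
  apply: eq_bigr => c c_j.
  rewrite (eq_bigr (fun=> g c)) => [|i /andP[_ /eqP->]//].
  rewrite sumr_const mulr_natl; congr (_ *+ _).
  rewrite (eq_card (B := [pred i | col i == c])) => [|i].
    by case: (c) => [b|] /=; rewrite ?cS ?cN.
  by rewrite !inE; apply: andb_idl => /eqP ->.
apply/eigenvalueP; exists (\row_i f (col i)); last first.
  have /card_gt0P[i] : (0 < #|[pred i | col i == None]|)%N by rewrite cN.
  rewrite inE => /eqP ci; apply/eqP => /rowP/(_ i)/eqP.
  by rewrite !mxE ci /f pnatr_eq0 muln_eq0 /= -leqn0 leqNgt q_gt0.
apply/rowP=> j; rewrite mul_col_signless !mxE -sum1_card natr_sum.
rewrite (sumcol (fun=> 1)).
under [X in _ + X]eq_bigr => i _ do rewrite mxE.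
rewrite (sumcol f) !sum_option_bool /f.
move: quad; rewrite !natrD !natrM.
move: (p%:R : algC) (q%:R : algC) => P Q quad.
case: (col j) => [[]|] /=; [| |by ring].
all: by apply/eqP; rewrite eq_sym -subr_eq0; apply/eqP; rewrite -[RHS]quad; ring.
Qed.

(** * Roots of the quadratic attached to the tripartite case *)

Lemma quadratic_root (b c : algC) : exists a, a ^+ 2 - b * a + c = 0.
Proof.
exists ((b + sqrtC (b ^+ 2 - 4 * c)) / 2).
have := sqrtCK (b ^+ 2 - 4 * c); move: (sqrtC _) => s s2.
have -> : c = (b ^+ 2 - s ^+ 2) / 4 by rewrite s2; field.
by field.
Qed.

(** Factor 16 as [d * (2 * k + d)] with [d] the difference of [m + 3] and [k], so [d] is at most 4.
    Odd [d] fails by parity; [d = 2] and [d = 4] would give [m = 2] and [m = 1]. *)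
Lemma square_sub16 (m k : nat) : (3 <= m)%N -> (k ^ 2 + 16 = (m + 3) ^ 2)%N -> False.
Proof.
move=> m3 E.
have [d dE] : exists d, (m + 3 = k + d)%N by exists (m + 3 - k)%N; nia.
have {E} E : (16 = d * (2 * k + d))%N by rewrite dE in E; nia.
have d_le : (d <= 4)%N by nia.
by case: d d_le dE E => [|[|[|[|[|d]]]]] //; lia.
Qed.

Lemma quadratic_no_int_root (m q : nat) (z : int) :
  (3 <= m)%N -> (0 < q)%N ->
  z ^+ 2 - (m.-1 * q + 4 * q)%:Z * z + (4 * q ^ 2)%:Z <> 0.
Proof.
(* Completing the square: [t] is a square root of the discriminant. *)
move=> m3 q0 zE; pose t := 2 * z - ((m + 3) * q)%:Z.
have mq : (m.-1 * q + 4 * q = (m + 3) * q)%N.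
  by rewrite -mulnDl; congr (_ * _)%N; lia.
have tE : (`|t| ^ 2 + 16 * q ^ 2 = ((m + 3) ^ 2) * q ^ 2)%N.
  have : t ^+ 2 + 16 * q%:Z ^+ 2 = ((m + 3) * q)%:Z ^+ 2.
    rewrite -[LHS]subr0 -(mulr0 4) -zE mq /t !PoszM; ring.
  by clear; nia.
(* Here [q ^ 2] divides the square of [t], so [q] divides [t] and the equation can be divided by
   [q ^ 2]. *)
have /dvdnP[k kE] : (q %| `|t|)%N.
  rewrite -(@dvdn_pexp2r _ _ 2) // -(@dvdn_addl (16 * q ^ 2)%N); last exact: dvdn_mull.
  by rewrite tE; exact: dvdn_mull.
move: tE; rewrite kE expnMn -mulnDl => /eqP; rewrite eqn_pmul2r ?expn_gt0 ?q0 // => /eqP.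
exact: square_sub16.
Qed.

(** * Transfer to the NCCC-graph and conclusion *)

Lemma nccc_signless (gT : finGroupType) (G : {group gT}) (T : eqType) (p : gT -> T) :
  {in (G :\: 'Z(G))%g &, forall g h, nccc_adj (g ^: G)%g (h ^: G)%g = (p g != p h)} ->
  nccc_signless_laplacian G =
  signless (col_adjmx algC (fun i : 'I_(nccc_n G) => p (repr (nccc_vertex i)))).
Proof.
move=> adjE.
suffices M : nccc_adjmx G = col_adjmx algC (fun i => p (repr (nccc_vertex i))).
  by rewrite /nccc_signless_laplacian /nccc_degmx M.
apply/matrixP=> i j; rewrite !mxE.
have [G'i Ci] := nccc_vertex_repr (enum_valP i).
have [G'j Cj] := nccc_vertex_repr (enum_valP j).
by have := adjE _ _ G'i G'j; rewrite -Ci -Cj /nccc_vertex => ->.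
Qed.

Lemma card_nccc_vertex (gT : finGroupType) (G : {group gT}) (P : pred {set gT}) :
  #|[pred i : 'I_(nccc_n G) | P (nccc_vertex i)]| = #|[set C in nccc_vertices G | P C]|.
Proof.
rewrite -!sum1_card.
rewrite (eq_bigl (fun C => (C \in nccc_vertices G) && P C)) => [|C]; last by rewrite inE.
by rewrite [RHS]big_enum_val_cond.
Qed.

Theorem theorem3p5 (gT : finGroupType) (G : {group gT}) (m : nat) :
  (3 <= m)%N -> (G / 'Z(G) \isog 'D_(2 * m))%g ->
  (Q_integral_nccc G <-> odd m).
Proof.
move=> m_ge3 isoD; have [p [adjE odd_p even_p]] := nccc_multipartite m_ge3 isoD.
split=> [Qint|/odd_p p_neq a].
  apply: contraT => /even_p[q q_gt0 [cN cS]].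
  (* A root of the quadratic is an eigenvalue; Q-integrality would make it an integer root. *)
  have [a quad] := quadratic_root (m.-1 * q + 4 * q)%:R (4 * q ^ 2)%:R.
  have /Qint/intrP[z az] : eigenvalue (nccc_signless_laplacian G) a.
    rewrite (nccc_signless adjE).
    apply: (@tripartite_eigenvalue _ (m.-1 * q) q) => // [|b|].
    - by rewrite (card_nccc_vertex G (fun C => p (repr C) == None)).
    - by rewrite (card_nccc_vertex G (fun C => p (repr C) == Some b)).
    by rewrite muln_gt0 q_gt0 -subn1 subn_gt0 ltnW.
  case: (@quadratic_no_int_root m q z m_ge3 q_gt0); apply: (@intr_inj algC).
  by rewrite rmorphD rmorphB rmorphXn rmorphM /= -az.
(* For odd [m] the label [Some false] never occurs, so testing against [None] already separates the
   parts. *)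
rewrite (@nccc_signless _ _ _ (fun g => p g == None)); first exact: bipartite_eigenvalue.
move=> g h G'g G'h; rewrite adjE //.
by move: (p g) (p h) (p_neq g G'g) (p_neq h G'h) => [[]|] [[]|].
Qed.
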